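(* Let $d\in\mathbb N$, $B\in\mathbb N$, $\alpha>0$, $\Delta t>0$ and $\gamma\in(0,1)$ be fixed, and consider the sparse load-balancing queueing model described in the context. Let $(G_n,\mathbf z_n)_{n\in\mathbb N}$ be a sequence of (possibly random) finite graphs with maximal degree at most $d$ together with initial queue states, converging in probability in the local weak sense to a (possibly infinite, possibly random) rooted marked graph $(G,\mathbf z)$. Then for any policy $\pi$, $$\lim_{n\to\infty} J^{G_n,\mathbf z_n}(\pi) = J^{G,\mathbf z}(\pi).$$
   Context: Queueing model. A system is given by an undirected graph $G=(\mathcal N,\mathcal E)$ of maximal degree at most $d$ (every node has at least one neighbour); each node $i\in\mathcal N$ is an agent (scheduler) owning one FIFO queue with buffer capacity $B$, so the local state is $z_i\in\mathcal Z:=\{0,1,\dots,B\}$. Let $N_i=\{j:(i,j)\in\mathcal E\}$ denote the neighbours of $i$. Time is divided into decision epochs $t=0,1,2,\dots$ of length $\Delta t$. A shared per-agent arrival rate $\lambda(t)>0$ evolves as a finite-state Markov chain (Markov-modulated Poisson arrivals, e.g. switching between two positive rates $\lambda_h,\lambda_l$), common to all agents. A policy is a sequence $\pi=(\pi_t)_{t\ge0}$ of decision rules $\pi_t:\mathcal Z\to[0,1]$. At the start of epoch $t$, each agent $i$ independently samples an action $a_i(t)\in\{0,1\}$ with $\mathbb P(a_i(t)=1)=\pi_t(z_i(t))$; action $0$ means all jobs arriving at agent $i$ during the epoch are sent to its own queue, action $1$ means each such job is sent to a uniformly random neighbour's queue. Consequently, during epoch $t$ queue $i$ evolves (independently across queues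 given the actions and $\lambda(t)$) as a continuous-time birth–death chain on $\mathcal Z$ for time $\Delta t$, with arrival rate $\lambda^i_t=\lambda(t)\big(1-a_i(t)+\sum_{j\in N_i} a_j(t)/|N_j|\big)$ (transition $z\to z+1$ for $z<B$) and service rate $\alpha$ (transition $z\to z-1$ for $z>0$); an arrival finding the queue in state $B$ is dropped. Let $D_i(t)$ be the expected number of dropped jobs at queue $i$ during epoch $t$ given the states and actions at the start of the epoch. Objectives. For a finite graph $G_n$ with initial states $\mathbf z_n$, let $D^N(t)=\frac1{|G_n|}\sum_{i\in G_n}D_i(t)$ and $J^{G_n,\mathbf z_n}(\pi)=-\mathbb E\big[\sum_{t=0}^\infty\gamma^t D^N(t)\big]$. For the limiting rooted marked graph $(G,\varnothing,\mathbf z)$ run under the same dynamics, let $D(t)=D_\varnothing(t)$ be the expected drops at the root node and $J^{G,\mathbf z}(\pi)=-\mathbb E\big[\sum_{t=0}^\infty\gamma^tD(t)\big]$. Local weak convergence. $\mathcal G_*$ is the space of marked rooted graphs $(G,\varnothing,\mathbf z)$ (graph, root node, marks $\mathbf z\in\mathcal Z^{\mathcal N}$). Let $B_k(G,\varnothing,\mathbf z)$ be the marked rooted subgraph induced by the $k$-hop neighbourhood of the root. $(G_n,\varnothing_n,\mathbf z_n)\to(G,\varnothing,\mathbf z)$ in $\mathcal G_*$ if for every $k$ there is $n'$ such that for all $n>n'$ there is a mark-preserving rooted isomorphism $B_k(G_n,\varnothing_n,\mathbf z_n)\to B_k(G,\varnothing,\mathbf z)$. A sequence of finite marked graphs $(G_n,\mathbf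 z_n)$ converges in probability in the local weak sense to $(G,\mathbf z)$ if $\frac1{|G_n|}\sum_{i\in G_n}f(C_i(G_n))\to\mathbb E[f(G,\varnothing,\mathbf z)]$ in probability for every bounded continuous $f:\mathcal G_*\to\mathbb R$, where $C_i(G_n)$ is the connected component of $i$ in $G_n$ rooted at $i$ with marks $\mathbf z_n$. *)

(* Defs.v *)
From HB Require Import structures.
From mathcomp Require Import all_boot all_order all_algebra.
From mathcomp Require Import all_classical all_reals all_analysis.
Set Implicit Arguments. Unset Strict Implicit. Unset Printing Implicit Defensive.
Import Order.TTheory GRing.Theory Num.Theory.
Import numFieldNormedType.Exports.
Local Open Scope ring_scope.
Local Open Scope classical_set_scope.

(* Parameters of the model other than the buffer size B and the policy.      *)
(*   alpha : service rate, dt : epoch length,                                *)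
(*   lam l : arrival rate in modulating state l (L finite),                   *)
(*   K l l' : transition matrix of the modulating chain lambda(t),           *)
(*   nu : initial law of the modulating chain.                               *)
Record qmodel (R : realType) (L : finType) := QModel {
  q_alpha : R; q_dt : R; q_lam : L -> R; q_K : L -> L -> R; q_nu : L -> R }.

(* Generator of the birth-death chain on {0,..,B} with arrival rate r and    *)
(* service rate alpha (arrivals in state B are dropped: no transition).      *)
Definition bd_gen (R : pzRingType) (B : nat) (alpha r : R) : 'M[R]_B.+1 :=
  \matrix_(i, j)
    if (val j == (val i).+1)%N then r
    else if (val i == (val j).+1)%N then alpha
    else if i == j then - ((if (val i < B)%N then r else 0)
                           + (if (0 < val i)%N then alpha else 0))
    else 0.

Definition expm (R : realType) (n : nat) (A : 'M[R]_n.+1) : 'M[R]_n.+1 :=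
  \matrix_(i, j) limn (fun m => \sum_(k < m) (A ^+ k) i j / (k`!)%:R).

Definition ptrans (R : realType) (B : nat) (alpha dt r : R) (z z' : 'I_B.+1) : R :=
  expm (dt *: bd_gen B alpha r) z z'.

(* Expected number of dropped jobs during an epoch of length dt, starting in *)
(* state z with arrival rate r: r * int_0^dt P(z(s) = B) ds.                 *)
Definition edrops (R : realType) (B : nat) (alpha dt r : R) (z : 'I_B.+1) : R :=
  r * Rintegral (@lebesgue_measure R) `[0, dt]
        (fun s => expm (s *: bd_gen B alpha r) z ord_max).

(* Sum over all configurations x : V -> X that agree with base outside of   *)
(* the (duplicate-free) finite list S.                                       *)
Fixpoint sum_conf (R : pzRingType) (V : eqType) (X : finType)
    (S : seq V) (base : V -> X) (f : (V -> X) -> R) : R :=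
  match S with
  | [::] => f base
  | v :: S' => \sum_(x : X) sum_conf S' (fun w => if w == v then x else base w) f
  end.

Definition bern (R : pzRingType) (p : R) (b : bool) : R := if b then p else 1 - p.

Definition nbhd (V : eqType) (nb : V -> seq V) (S : seq V) : seq V :=
  undup (S ++ flatten (map nb S)).

Definition qrate (R : fieldType) (V : eqType) (nb : V -> seq V) (l : R)
    (a : V -> bool) (v : V) : R :=
  l * ((if a v then 0 else 1) + \sum_(j <- nb v) (if a j then (size (nb j))%:R^-1 else 0)).

(* One-step backward (transition) operator of the whole system at epoch s,   *)
(* applied to a function h of (lambda(s+1), z(s+1)) that depends only on the *)
(* coordinates of z in S: returns E[h(lambda(s+1), z(s+1)) | lambda(s) = l,  *)
(* z(s) = z].  Actions of all agents of S and their neighbours are sampled   *)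
(* independently with P(a_u = 1) = pi_s(z_u); queues evolve independently   *)
(* as birth-death chains for time dt; then lambda jumps according to K.      *)
Definition step (R : realType) (L : finType) (B : nat) (M : qmodel R L)
    (pi : nat -> 'I_B.+1 -> R) (V : eqType) (nb : V -> seq V) (s : nat)
    (S : seq V) (h : L -> (V -> 'I_B.+1) -> R) (l : L) (z : V -> 'I_B.+1) : R :=
  let U := nbhd nb S in
  sum_conf U (fun _ => false) (fun a =>
    (\prod_(u <- U) bern (pi s (z u)) (a u)) *
    sum_conf (undup S) z (fun z' =>
      (\prod_(v <- undup S)
          ptrans (q_alpha M) (q_dt M) (qrate nb (q_lam M l) a v) (z v) (z' v)) *
      \sum_(l' : L) q_K M l l' * h l' z')).

Fixpoint growN (V : eqType) (nb : V -> seq V) (n : nat) (S : seq V) : seq V :=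
  match n with 0 => S | n'.+1 => nbhd nb (growN nb n' S) end.

(* cexp s n S g l z = E[g(lambda(s+n), z(s+n)) | lambda(s) = l, z(s) = z]   *)
(* for g depending only on the coordinates in S.                              *)
Fixpoint cexp (R : realType) (L : finType) (B : nat) (M : qmodel R L)
    (pi : nat -> 'I_B.+1 -> R) (V : eqType) (nb : V -> seq V) (s n : nat)
    (S : seq V) (g : L -> (V -> 'I_B.+1) -> R) : L -> (V -> 'I_B.+1) -> R :=
  match n with
  | 0 => g
  | n'.+1 => step M pi nb s (growN nb n' S) (cexp M pi nb s.+1 n' S g)
  end.

Definition dropf (R : realType) (L : finType) (B : nat) (M : qmodel R L)
    (pi : nat -> 'I_B.+1 -> R) (V : eqType) (nb : V -> seq V) (t : nat) (v : V)
    (l : L) (z : V -> 'I_B.+1) : R :=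
  let U := nbhd nb [:: v] in
  sum_conf U (fun _ => false) (fun a =>
    (\prod_(u <- U) bern (pi t (z u)) (a u)) *
    edrops (q_alpha M) (q_dt M) (qrate nb (q_lam M l) a v) (z v)).

Definition ED (R : realType) (L : finType) (B : nat) (M : qmodel R L)
    (pi : nat -> 'I_B.+1 -> R) (V : eqType) (nb : V -> seq V)
    (z0 : V -> 'I_B.+1) (v : V) (t : nat) : R :=
  \sum_(l : L) q_nu M l * cexp M pi nb 0 t (nbhd nb [:: v]) (dropf M pi nb t v) l z0.

Record mfgraph (B : nat) := FGraph {
  fN : nat; fnb : 'I_fN -> seq 'I_fN; fmark : 'I_fN -> 'I_B.+1 }.

Definition mfgraph_ok (B d : nat) (H : mfgraph B) : Prop :=
  (0 < fN H)%N /\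
  forall i : 'I_(fN H),
    [/\ uniq (fnb i), i \notin fnb i, (0 < size (fnb i) <= d)%N &
        forall j, (j \in fnb i) = (i \in fnb j)].

(* Rooted marked graph (only the connected component of the root matters);  *)
(* vertices are natural numbers.                                             *)
Record rmgraph (B : nat) := RGraph {
  rnb : nat -> seq nat; rroot : nat; rmark : nat -> 'I_B.+1 }.

Fixpoint ball (nb : nat -> seq nat) (k r : nat) : seq nat :=
  match k with 0 => [:: r] | k'.+1 => nbhd nb (ball nb k' r) end.

Definition reachable (B : nat) (g : rmgraph B) (v : nat) : Prop :=
  exists k, v \in ball (rnb g) k (rroot g).

Definition rgood (B : nat) (g : rmgraph B) : Prop :=
  forall v, reachable g v ->
    [/\ uniq (rnb g v), v \notin rnb g v &
        forall u, (u \in rnb g v) = (v \in rnb g u)].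

Definition rdeg_ok (B d : nat) (g : rmgraph B) : Prop :=
  forall v, reachable g v -> (0 < size (rnb g v) <= d)%N.

Definition ball_iso (B : nat) (k : nat) (g h : rmgraph B) : Prop :=
  exists phi : nat -> nat,
    [/\ phi (rroot g) = rroot h,
        perm_eq (map phi (ball (rnb g) k (rroot g))) (ball (rnb h) k (rroot h)),
        {in ball (rnb g) k (rroot g), forall v, rmark h (phi v) = rmark g v} &
        {in ball (rnb g) k (rroot g) &, forall u v,
            (phi v \in rnb h (phi u)) = (v \in rnb g u)}].

Definition lw_bounded (R : realType) (B : nat) (f : rmgraph B -> R) : Prop :=
  exists Mb : R, forall g, rgood g -> `|f g| <= Mb.

Definition lw_continuous (R : realType) (B : nat) (f : rmgraph B -> R) : Prop :=
  forall g, rgood g -> forall eps : R, 0 < eps ->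
    exists k, forall h, rgood h -> ball_iso k g h -> `|f g - f h| < eps.

Definition froot (B : nat) (H : mfgraph B) (i : 'I_(fN H)) : rmgraph B :=
  RGraph (fun v => match (insub v : option 'I_(fN H)) with
                   | Some j => map val (fnb j) | None => [::] end)
         (val i)
         (fun v => match (insub v : option 'I_(fN H)) with
                   | Some j => fmark j | None => ord0 end).

Definition emp_avg (R : realType) (B : nat) (f : rmgraph B -> R) (H : mfgraph B) : R :=
  (fN H)%:R^-1 * \sum_(i < fN H) f (froot i).

Definition Jfin (R : realType) (L : finType) (B : nat) (M : qmodel R L)
    (gamma : R) (pi : nat -> 'I_B.+1 -> R) (H : mfgraph B) : R :=
  - limn (fun m => \sum_(t < m) gamma ^+ t *
            ((fN H)%:R^-1 * \sum_(i < fN H) ED M pi (@fnb B H) (@fmark B H) i t)).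

Definition Jroot (R : realType) (L : finType) (B : nat) (M : qmodel R L)
    (gamma : R) (pi : nat -> 'I_B.+1 -> R) (g : rmgraph B) : R :=
  - limn (fun m => \sum_(t < m) gamma ^+ t * ED M pi (rnb g) (rmark g) (rroot g) t).

(* Main.v *)
Require Import Defs.
From HB Require Import structures.
From mathcomp Require Import all_boot all_order all_algebra.
From mathcomp Require Import ring.
From mathcomp Require Import all_classical all_reals all_analysis.
From mathcomp Require Import measurable_realfun.
Set Implicit Arguments.
Unset Strict Implicit.
Unset Printing Implicit Defensive.
Import Order.TTheory GRing.Theory Num.Theory.
Import numFieldNormedType.Exports.
Local Open Scope ring_scope.
Local Open Scope classical_set_scope.

(* The expected drops at a node during epoch t depend only on the (t+2)-ball of *)
(* that node up to isomorphism, and they are bounded uniformly in t: all        *)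
(* conditional expectations are averages against stochastic weights, so only    *)
(* the bound (arrival rate) * dt on the drops of one epoch matters.  Hence the  *)
(* discounted sum is a bounded continuous function of the rooted marked graph;  *)
(* Jfin is its empirical average and Jroot its value at the limit, so that      *)
(* local weak convergence in probability followed by bounded convergence        *)
(* concludes.                                                                   *)

(** * Local isomorphism invariance of the dynamics *)

(** The cost is a local observable up to a geometric error. In the backward recursion information
    travels one hop per epoch, so the expected drops in epoch [t] are determined by finitely many
    hops ([ED_iso]). One constant bounds them for all epochs ([ED_le]), so disagreement from epoch
    [k] on costs at most a multiple of [gamma ^+ k] ([discounted_sub_le]). Hence [Jcut] is bounded
    and continuous for local convergence ([Jcut_le], [Jcut_continuous]). The finite-graph cost is
    its empirical average ([Jfin_emp_avg]), so it converges in probability to a constant, and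
    boundedness upgrades this to convergence of expectations ([cvg_Rintegral_in_probability]).

    The analytic input is that the exponential of a birth-death generator, given as a power series,
    is a stochastic matrix ([expm_ge0], [expm_row_sum]). *)

Section SumConf.
Context {R : pzRingType} {V : eqType} {X : finType}.
Implicit Types (S : seq V) (b : V -> X) (f : (V -> X) -> R).

Lemma eq_sum_conf S b f f' :
  (forall y, (forall w, w \notin S -> y w = b w) -> f y = f' y) ->
  sum_conf S b f = sum_conf S b f'.
Proof.
elim: S b => [|v S IH] b ff' /=; first exact: ff'.
apply: eq_bigr => x _; apply: IH => y yb; apply: ff' => w.
by rewrite inE negb_or => /andP[wv wS]; rewrite yb // (negbTE wv).
Qed.

(** Finite sums commute, and so do updates of the base at distinct vertices. This lets an
    isomorphism match vertex lists that agree only up to permutation. *)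
Lemma sum_conf_rem S v b f : uniq S -> v \in S ->
  sum_conf S b f =
  \sum_x sum_conf (rem v S) (fun w => if w == v then x else b w) f.
Proof.
elim: S b => [//|u S IH] b /= /andP[uS uqS]; rewrite inE.
have [<-|uv] := eqVneq u v; first by move=> _.
rewrite /= => vS.
under eq_bigr do rewrite IH //.
rewrite exchange_big /=; apply: eq_bigr => x _; apply: eq_bigr => y _.
congr (sum_conf _ _ _); apply/funext => w.
by have [->|//] := eqVneq w v; rewrite eq_sym (negbTE uv).
Qed.

Lemma sum_conf_mulr S b c f :
  sum_conf S b (fun y => c * f y) = c * sum_conf S b f.
Proof.
elim: S b => [//|v S IH] b /=; rewrite mulr_sumr.
by apply: eq_bigr => x _; rewrite IH.
Qed.

End SumConf.

(** [T] is the region on which the summands depend. It may exceed [S], because coordinates outside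
    [S] stay frozen at the base but can still be read. *)
Lemma sum_conf_iso (R : pzRingType) (V V' : eqType) (X : finType)
    (phi : V -> V') (S T : seq V) (S' : seq V') b b'
    (f : (V -> X) -> R) (f' : (V' -> X) -> R) :
  uniq S -> perm_eq (map phi S) S' -> {subset S <= T} ->
  {in T &, injective phi} -> {in T, b' \o phi =1 b} ->
  (forall y y', {in T, y' \o phi =1 y} -> f y = f' y') ->
  sum_conf S b f = sum_conf S' b' f'.
Proof.
elim: S S' b b' => [|v S IH] S' b b' uS pS ST phiI bb' ff'.
  by move: pS; rewrite perm_sym => /perm_nilP -> /=; exact: ff'.
have vT : v \in T by apply: ST; rewrite mem_head.
have vS' : phi v \in S' by rewrite -(perm_mem pS) mem_head.
have uS' : uniq S'.
  rewrite -(perm_uniq pS) map_inj_in_uniq // => x y xS yS.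
  by apply: phiI; exact: ST.
rewrite (sum_conf_rem _ _ uS' vS') /=; apply: eq_bigr => x _.
apply: IH => //; first by case/andP: uS.
- by rewrite -(perm_cons (phi v)) (perm_trans pS) // perm_to_rem.
- by move=> w wS; apply: ST; rewrite inE wS orbT.
- by move=> w wT /=; rewrite (inj_in_eq phiI) //; case: ifP => // _; exact: bb'.
Qed.

(** The weights form a product probability. Once the head vertex is fixed to [x] its factor is
    constant, so the sum is a convex combination of sums over the tail. *)
Lemma sum_conf_weight_le (R : realDomainType) (V : eqType) (X : finType)
    (S : seq V) (b : V -> X) (p : V -> X -> R) (f : (V -> X) -> R) (C : R) :
  uniq S -> (forall v x, 0 <= p v x) -> (forall v, \sum_x p v x = 1) ->
  (forall y, `|f y| <= C) ->
  `|sum_conf S b (fun y => (\prod_(v <- S) p v (y v)) * f y)| <= C.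
Proof.
move=> + p0 p1 fC; elim: S b => [|v S IH] b; first by rewrite /= big_nil mul1r.
rewrite cons_uniq => /andP[vS uS].
have -> : sum_conf (v :: S) b (fun y => (\prod_(u <- v :: S) p u (y u)) * f y) =
    \sum_x p v x * sum_conf S (fun w => if w == v then x else b w)
                 (fun y => (\prod_(u <- S) p u (y u)) * f y).
  apply: eq_bigr => x _; rewrite -sum_conf_mulr; apply: eq_sum_conf => y yb.
  by rewrite big_cons yb // eqxx mulrA.
apply: (le_trans (ler_norm_sum _ _ _)); have -> : C = \sum_x p v x * C by rewrite -mulr_suml p1 mul1r.
apply: ler_sum => x _; rewrite normrM ger0_norm //.
by apply: ler_wpM2l => //; exact: IH.
Qed.

Section Neighbourhood.
Context {V : eqType} (nb : V -> seq V).

Lemma mem_nbhd S w : (w \in nbhd nb S) = (w \in S) || has (fun v => w \in nb v) S.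
Proof.
rewrite mem_undup mem_cat; congr (_ || _).
by apply/flatten_mapP/hasP => -[v]; exists v.
Qed.

Lemma sub_nbhd S : {subset S <= nbhd nb S}.
Proof. by move=> w wS; rewrite mem_nbhd wS. Qed.

Lemma nb_nbhd S v w : v \in S -> w \in nb v -> w \in nbhd nb S.
Proof. by move=> vS wv; rewrite mem_nbhd; apply/orP; right; apply/hasP; exists v. Qed.

Lemma growN_uniq n S : uniq S -> uniq (growN nb n S).
Proof. by case: n => [//|n] _; exact: undup_uniq. Qed.

Lemma sub_growN m n S : (m <= n)%N -> {subset growN nb m S <= growN nb n S}.
Proof.
elim: n => [|n IH]; first by rewrite leqn0 => /eqP ->.
rewrite leq_eqVlt => /orP[/eqP -> //|]; rewrite ltnS => /IH mn w /mn.
exact: sub_nbhd.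
Qed.

End Neighbourhood.

Section LocalIso.
Context {R : realType} {L : finType} {B : nat} (M : qmodel R L).
Context (pi : nat -> 'I_B.+1 -> R) {V V' : eqType} (phi : V -> V').
Context (nb : V -> seq V) (nb' : V' -> seq V').
Let nb_iso (D : seq V) := {in D, forall v, perm_eq (map phi (nb v)) (nb' (phi v))}.

Lemma nbhd_iso S S' : perm_eq (map phi S) S' -> nb_iso S ->
  {in nbhd nb S &, injective phi} ->
  perm_eq (map phi (nbhd nb S)) (nbhd nb' S').
Proof.
move=> pS nS phiI; apply: uniq_perm; rewrite ?undup_uniq //.
  by rewrite map_inj_in_uniq // undup_uniq.
move=> w; apply/mapP/idP => [[v]|]; rewrite !mem_nbhd.
- move=> /orP[vS ->|/hasP[u uS vu] ->]; first by rewrite -(perm_mem pS) map_f.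
  apply/orP; right; apply/hasP; exists (phi u); first by rewrite -(perm_mem pS) map_f.
  by rewrite -(perm_mem (nS u uS)) map_f.
- move=> /orP[|/hasP[u]]; rewrite -(perm_mem pS) => /mapP[v vS ->].
    by exists v => //; rewrite sub_nbhd.
  rewrite -(perm_mem (nS v vS)) => /mapP[x xv ->]; exists x => //.
  exact: nb_nbhd xv.
Qed.

Lemma growN_iso n S S' : perm_eq (map phi S) S' -> nb_iso (growN nb n S) ->
  {in growN nb n S &, injective phi} ->
  perm_eq (map phi (growN nb n S)) (growN nb' n S').
Proof.
elim: n => [//|n IH] pS nS phiI.
apply: nbhd_iso => //; first apply: IH => //.
- by move=> v vS; apply: nS; apply: sub_nbhd.
- by move=> v w vS wS; apply: phiI; apply: sub_nbhd.
- by move=> v vS; apply: nS; apply: sub_nbhd.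
Qed.

(** The rate at [v] involves the degrees of its neighbours, which is why neighbour lists must
    correspond on all of [nbhd nb S]. *)
Lemma qrate_iso S l a a' v : v \in S -> nb_iso (nbhd nb S) ->
  {in nbhd nb S, a' \o phi =1 a} ->
  qrate nb l a v = qrate nb' l a' (phi v) :> R.
Proof.
move=> vS nS aa'; have vU := sub_nbhd nb vS.
rewrite /qrate -(aa' v) //=; congr (_ * (_ + _)).
rewrite -(perm_big _ (nS v vU)) /= big_map; apply: eq_big_seq => j jv.
have jU : j \in nbhd nb S by exact: nb_nbhd jv.
by rewrite -(aa' j) //= -(perm_size (nS j jU)) size_map.
Qed.

Lemma bern_prod_iso (q : 'I_B.+1 -> R) U U' z z' a a' :
  perm_eq (map phi U) U' -> {in U, z' \o phi =1 z} -> {in U, a' \o phi =1 a} ->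
  \prod_(u <- U) bern (q (z u)) (a u) = \prod_(u <- U') bern (q (z' u)) (a' u).
Proof.
move=> pU zz' aa'; rewrite -(perm_big _ pU) /= big_map; apply: eq_big_seq => u uU.
by rewrite -zz' // -aa'.
Qed.

Lemma step_iso s S S' h h' l z z' : uniq S -> perm_eq (map phi S) S' ->
  nb_iso (nbhd nb S) -> {in nbhd nb S &, injective phi} ->
  {in nbhd nb S, z' \o phi =1 z} ->
  (forall k y y', {in S, y' \o phi =1 y} -> h k y = h' k y') ->
  step M pi nb s S h l z = step M pi nb' s S' h' l z'.
Proof.
move=> uS pS nS phiI zz' hh'.
have sS := @sub_nbhd _ nb S.
have phiIS : {in S &, injective phi} by move=> v w vS wS; apply: phiI; exact: sS.
have uS' : uniq S' by rewrite -(perm_uniq pS) map_inj_in_uniq.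
have pU : perm_eq (map phi (nbhd nb S)) (nbhd nb' S').
  by apply: nbhd_iso => // v vS; exact: nS (sS _ vS).
rewrite /step !undup_id //; apply: (@sum_conf_iso _ _ _ _ phi _ (nbhd nb S)) => //.
  exact: undup_uniq.
move=> a a' aa'; congr (_ * _); first exact: bern_prod_iso.
apply: (@sum_conf_iso _ _ _ _ phi _ S) => //; first by move=> v /sS; exact: zz'.
move=> y y' yy'; congr (_ * _); last first.
  by apply: eq_bigr => k _; congr (_ * _); exact: hh'.
rewrite -(perm_big _ pS) /= big_map; apply: eq_big_seq => v vS.
rewrite -(yy' v vS) -(zz' v (sS v vS)).
by rewrite (qrate_iso _ vS nS aa').
Qed.

(** Each backward epoch widens the domain of dependence by one hop, which [step_iso] absorbs. *)
Lemma cexp_iso s n S S' g g' l z z' : uniq S -> perm_eq (map phi S) S' ->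
  nb_iso (growN nb n S) -> {in growN nb n S &, injective phi} ->
  {in growN nb n S, z' \o phi =1 z} ->
  (forall k y y', {in S, y' \o phi =1 y} -> g k y = g' k y') ->
  cexp M pi nb s n S g l z = cexp M pi nb' s n S' g' l z'.
Proof.
move=> uS pS; elim: n s l z z' => [|n IH] s l z z' nS phiI zz' gg'; first exact: gg'.
have sS := @sub_nbhd _ nb (growN nb n S).
have nS' : nb_iso (growN nb n S) by move=> v vS; exact: nS (sS _ vS).
have phiI' : {in growN nb n S &, injective phi}.
  by move=> v w vS wS; apply: phiI; exact: sS.
apply: step_iso => //; first exact: growN_uniq.
  exact: growN_iso.
by move=> k y y' yy'; exact: IH.
Qed.

Lemma dropf_iso t v l z z' : nb_iso (nbhd nb [:: v]) ->
  {in nbhd nb [:: v] &, injective phi} -> {in nbhd nb [:: v], z' \o phi =1 z} ->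
  dropf M pi nb t v l z = dropf M pi nb' t (phi v) l z'.
Proof.
move=> nS phiI zz'; have sS := @sub_nbhd _ nb [:: v].
have pU : perm_eq (map phi (nbhd nb [:: v])) (nbhd nb' [:: phi v]).
  by apply: nbhd_iso => // w wS; exact: nS (sS _ wS).
apply: (@sum_conf_iso _ _ _ _ phi _ (nbhd nb [:: v])) => //.
  exact: undup_uniq.
move=> a a' aa'; rewrite (bern_prod_iso (pi t) pU zz' aa') -(zz' v (sS v (mem_head v [::]))).
by rewrite (qrate_iso _ (mem_head v [::]) nS aa').
Qed.

(** The radius is one hop for the actions in the drop epoch plus one for each of the [t] earlier
    epochs. *)
Lemma ED_iso t v z z' : nb_iso (growN nb t.+1 [:: v]) ->
  {in growN nb t.+1 [:: v] &, injective phi} ->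
  {in growN nb t.+1 [:: v], z' \o phi =1 z} ->
  ED M pi nb z v t = ED M pi nb' z' (phi v) t.
Proof.
have growNS k : growN nb k (nbhd nb [:: v]) = growN nb k.+1 [:: v].
  by elim: k => [//|k IH] /=; rewrite IH.
move=> nS phiI zz'; have sS := @sub_growN _ nb 1 t.+1 [:: v] isT.
have nS1 : nb_iso (nbhd nb [:: v]) by move=> w /sS; exact: nS.
have phiI1 : {in nbhd nb [:: v] &, injective phi}.
  by move=> w w' /sS wS /sS wS'; exact: phiI.
apply: eq_bigr => l _; congr (_ * _); apply: cexp_iso; rewrite ?growNS //.
- exact: undup_uniq.
- by apply: nbhd_iso => // w /(@sub_nbhd _ nb); exact: nS1.
- by move=> k y y' yy'; exact: dropf_iso.
Qed.

End LocalIso.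

(** * Matrix exponentials and birth-death chains *)

Lemma cvg_sumr (R : realType) (I : Type) (r : seq I) (u : I -> R^nat) (l : I -> R) :
  (forall i, u i @ \oo --> l i) ->
  \sum_(i <- r) u i m @[m --> \oo] --> \sum_(i <- r) l i.
Proof.
by move=> ul; apply: (cvg_big (op := +%R) (P := xpredT)) => //; exact: add_continuous.
Qed.

Section Expm.
Context {R : realType} {n : nat}.
Implicit Types A : 'M[R]_n.+1.

(** The sum of all absolute entries dominates every absolute row sum, so one more factor of [A]
    costs at most that constant. The exponential series is then dominated by a scalar one. *)
Lemma mxpow_le A k i j : `|(A ^+ k) i j| <= (\sum_a \sum_b `|A a b|) ^+ k.
Proof.
elim: k i j => [|k IH] i j.
  by rewrite !expr0 mxE; case: eqP; rewrite ?normr1 ?normr0 ?ler01.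
rewrite !exprS mxE mulr_suml.
apply: (le_trans (ler_norm_sum _ _ _)).
apply: (@le_trans _ _ (\sum_b `|A i b| * (\sum_a \sum_b `|A a b|) ^+ k)).
  by apply: ler_sum => b _; rewrite normrM ler_wpM2l.
rewrite -mulr_suml -[leRHS]mulr_suml; apply: ler_wpM2r.
  by rewrite exprn_ge0 // sumr_ge0 // => a _; rewrite sumr_ge0.
by rewrite [leRHS](bigD1 i) //= lerDl sumr_ge0 // => a _; rewrite sumr_ge0.
Qed.

Lemma is_cvg_expm_series A i j :
  cvgn (series (fun k => (A ^+ k) i j / k`!%:R)).
Proof.
apply: normed_cvg.
apply: (series_le_cvg _ _ _ (is_cvg_series_exp_coeff (\sum_a \sum_b `|A a b|))).
- by move=> k; exact: normr_ge0.
- move=> k; apply: exp_coeff_ge0; apply: sumr_ge0 => a _.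
  by rewrite sumr_ge0.
- move=> k; rewrite /exp_coeff /= normrM normfV normr_nat.
  by rewrite ler_wpM2r ?invr_ge0 ?mxpow_le.
Qed.

Lemma cvg_expm A i j :
  \sum_(k < m) (A ^+ k) i j / k`!%:R @[m --> \oo] --> expm A i j.
Proof.
rewrite mxE; have := @is_cvg_expm_series A i j.
suff -> : series (fun k => (A ^+ k) i j / k`!%:R) =
  (fun m => \sum_(k < m) (A ^+ k) i j / k`!%:R) by [].
by apply/funext => m; rewrite /series /= big_mkord.
Qed.

(** Positive powers of [A] also have zero row sums, so only the identity term contributes. *)
Lemma expm_row_sum A i : (forall a, \sum_j A a j = 0) -> \sum_j expm A i j = 1.
Proof.
move=> A0; have powS k a : \sum_j (A ^+ k.+1) a j = 0.
  rewrite exprSr; under eq_bigr do rewrite mxE.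
  by rewrite exchange_big big1 //= => b _; rewrite -mulr_sumr A0 mulr0.
have cS := @cvg_sumr _ _ (index_enum _) _ _ (fun j => @cvg_expm A i j).
rewrite -(cvg_lim (@Rhausdorff R) cS); apply: lim_near_cst => //.
near=> m; have m0 : (0 < m)%N by near: m; exact: nbhs_infty_gt.
rewrite -(prednK m0) exchange_big big_ord_recl /= [X in _ + X]big1 ?addr0; last first.
  by move=> k _; rewrite -mulr_suml powS mul0r.
under eq_bigr do rewrite expr0 mxE divr1.
by rewrite (bigD1 i) //= eqxx big1 ?addr0 // => j /negbTE; rewrite eq_sym => ->.
Unshelve. all: by end_near. Qed.

(* Write A = C - c with C entrywise nonnegative; the partial sums of exp A     *)
(* regroup as sums of C^p / p! times partial sums of exp (- c), which are      *)
(* eventually positive.                                                        *)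
Lemma expm_ge0 A i j :
  (forall a b, a != b -> 0 <= A a b) -> 0 <= expm A i j.
Proof.
move=> A0; pose c := \sum_a `|A a a|; pose C := A + c *: 1.
have powC p a b : 0 <= (C ^+ p) a b.
  elim: p a b => [|p IH] a b; first by rewrite expr0 mxE ler0n.
  rewrite exprS mxE sumr_ge0 // => e _; rewrite mulr_ge0 // !mxE.
  have [<-|ae] := eqVneq a e; last by rewrite mulr0 addr0 A0.
  rewrite mulr1 /c (bigD1 a) //= addrA addr_ge0 ?sumr_ge0 //.
  by rewrite -lerBlDl sub0r -normrN ler_norm.
pose E q : R := \sum_(k < q) (- c) ^+ k / k`!%:R.
pose T p := (C ^+ p) i j / p`!%:R.
have T0 p : 0 <= T p by rewrite divr_ge0.
(* Binomial theorem: [C] commutes with the scalar matrix [- c]. *)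
have AE k : (A ^+ k) i j / k`!%:R =
    \sum_(p < k.+1) T p * ((- c) ^+ (k - p) / (k - p)`!%:R).
  have -> : A = (- c) *: 1 + C by rewrite /C addrC scaleNr addrK.
  rewrite exprDn_comm; last first.
    by rewrite /GRing.comm -scalerAl -scalerAr mul1r mulr1.
  rewrite summxE mulr_suml; apply: eq_bigr => -[p /=]; rewrite ltnS => pk _.
  rewrite exprZn expr1n -scalerAl mul1r -scaler_nat !mxE /T -(bin_fact pk) !natrM.
  have f0 q : (q`!%:R : R) != 0 by rewrite pnatr_eq0 -lt0n fact_gt0.
  have b0 : ('C(k, p)%:R : R) != 0 by rewrite pnatr_eq0 -lt0n bin_gt0.
  by field; rewrite b0 !f0.
have SE N : \sum_(k < N) (A ^+ k) i j / k`!%:R = \sum_(p < N) T p * E (N - p)%N.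
  elim: N => [|N IH]; first by rewrite !big_ord0.
  rewrite big_ord_recr /= IH AE [RHS]big_ord_recr /= [in LHS]big_ord_recr /=.
  rewrite subnn subSn // subnn addrA -big_split /=; congr (_ + _).
    apply: eq_bigr => p _; rewrite -mulrDr /E subSn; last exact: ltnW.
    by rewrite [in RHS]big_ord_recr.
  by rewrite /E big_ord1.
have cE : E @ \oo --> expR (- c).
  have -> : E = series (exp_coeff (- c)); last exact: is_cvg_series_exp_coeff.
  by apply/funext => q; rewrite /E /series /= big_mkord.
have [n0 _ En0] := cvgr_ge _ cE _ (expR_gt0 (- c)).
have cT : T @ \oo --> 0 by exact: cvg_series_cvg_0 (@is_cvg_expm_series C i j).
(* In the partial sum of length [m + n0], only the last [n0] terms carry a factor [E] of index at
   most [n0], whose sign is uncertain. They vanish in the limit because [T] does; the other terms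
   are nonnegative. *)
have cT' : \sum_(q <- iota 0 n0) T (m + q)%N * E (n0 - q)%N @[m --> \oo] --> (0 : R).
  have cTE := @cvg_sumr _ _ (iota 0 n0) (fun q m => T (m + q)%N * E (n0 - q)%N)
    (fun q => 0 * E (n0 - q)%N).
  rewrite [X in _ --> X]big1 in cTE; last by move=> q _; rewrite mul0r.
  apply: cTE => q; apply: cvgMr_tmp.
  by rewrite (@cvg_shiftn q R^o T).
have cS : \sum_(k < m + n0) (A ^+ k) i j / k`!%:R @[m --> \oo] --> expm A i j.
  by rewrite (@cvg_shiftn n0 R^o (fun m => \sum_(k < m) (A ^+ k) i j / k`!%:R)); exact: cvg_expm.
apply: ler_cvg_to cT' cS _; near=> m.
rewrite SE big_split_ord /= -[leLHS]add0r; apply: lerD.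
  apply: sumr_ge0 => p _; apply: mulr_ge0 => //; apply: En0 => /=.
  by rewrite addnC -addnBA ?leq_addr // ltnW.
rewrite -[X in iota X _]/0%N -[n0 in iota _ n0]subn0 -/(index_iota 0 n0) big_mkord.
by apply: ler_sum => q _; rewrite subnDl.
Unshelve. all: by end_near. Qed.

End Expm.

(** The entry is a pointwise limit of polynomials in [s]. *)
Lemma measurable_expm (R : realType) (n : nat) (A : 'M[R]_n.+1) i j (D : set R) :
  measurable_fun D (fun s => expm (s *: A) i j).
Proof.
apply: (@measurable_fun_cvg _ (measurableTypeR R) R D
  (fun m (s : R) => \sum_(k < m) ((s *: A) ^+ k) i j / k`!%:R)
  (fun s : R => expm (s *: A) i j)); last first.
  by move=> s _; exact: cvg_expm.
move=> m; apply: measurable_sum => k.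
under eq_fun do rewrite exprZn mxE -mulrA.
apply: measurable_funM; last exact: measurable_cst.
exact: measurable_funX.
Qed.

Section BirthDeath.
Context {R : realType} {B : nat} (alpha : R) (alpha0 : 0 <= alpha).

Lemma bd_gen_row_sum (r : R) i : \sum_j bd_gen B alpha r i j = 0.
Proof.
(* The three cases of the generator are mutually exclusive, so the nested conditional becomes a sum
   of indicators that can be summed separately. *)
have E j : bd_gen B alpha r i j =
    (if (val j == (val i).+1)%N then r else 0) +
    (if (val i == (val j).+1)%N then alpha else 0) -
    (if j == i then (if (val i < B)%N then r else 0)
                    + (if (0 < val i)%N then alpha else 0) else 0).
  rewrite mxE [j == i]eq_sym; case: (eqVneq (val j) (val i).+1) => [ji|_].
    by rewrite ji -[i == j]val_eqE /= ji !(ltn_eqF) ?addr0 ?subr0 // -addn2 -addSnnS ltn_addr.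
  case: (eqVneq (val i) (val j).+1) => [ij|_].
    by rewrite -[i == j]val_eqE ij gtn_eqF // subr0 add0r.
  by case: eqVneq; rewrite ?addr0 ?subr0 ?sub0r.
under eq_bigr do rewrite E.
rewrite sumrB big_split /= -!big_mkcond /= big_pred1_eq; apply/eqP; rewrite subr_eq0.
apply/eqP; congr (_ + _).
- case: ltnP => iB.
    by rewrite (big_pred1 (Ordinal (iB : (val i).+1 < B.+1)%N)).
  rewrite big_pred0 // => j; apply/eqP => ji.
  by have := ltn_ord j; rewrite ltnS leqNgt [nat_of_ord j]ji ltnS iB.
- case: posnP => i0.
    by rewrite big_pred0 // => j; rewrite [nat_of_ord i]i0.
  have iB : ((val i).-1 < B.+1)%N by rewrite prednK //; exact: ltnW (ltn_ord i).
  rewrite (big_pred1 (Ordinal iB)) // => j.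
  by rewrite /pred1 /= -val_eqE /= -{1}(prednK i0) eqSS eq_sym.
Qed.

Context (r : R) (r0 : 0 <= r).

Lemma expm_bd_ge0 s i j : 0 <= s -> 0 <= expm (s *: bd_gen B alpha r) i j.
Proof.
move=> s0; apply: expm_ge0 => a b /negbTE ab; rewrite !mxE mulr_ge0 //.
by rewrite ab; case: ifP => // _; case: ifP.
Qed.

Lemma expm_bd_row_sum s i : \sum_j expm (s *: bd_gen B alpha r) i j = 1.
Proof.
apply: expm_row_sum => a; under eq_bigr do rewrite mxE.
by rewrite -mulr_sumr bd_gen_row_sum mulr0.
Qed.

(** The integrand is the probability of a full buffer, hence lies between 0 and 1. *)
Lemma edrops_le (dt : R) (z : 'I_B.+1) : 0 <= dt -> `|edrops alpha dt r z| <= r * dt.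
Proof.
move=> dt0; rewrite /edrops normrM (ger0_norm r0) ler_wpM2l //.
set f := fun s : R => expm _ _ _.
have f0 s : `[0, dt] s -> 0 <= f s.
  by rewrite /= in_itv => /andP[s0 _]; exact: expm_bd_ge0.
have f1 s : `[0, dt] s -> f s <= 1.
  rewrite /= in_itv => /andP[s0 _]; rewrite -(expm_bd_row_sum s z).
  by rewrite (bigD1 ord_max) //= lerDl sumr_ge0 // => j _; exact: expm_bd_ge0.
have mI : measurable (`[0, dt] : set R) by exact: measurable_itv.
have muI : (@lebesgue_measure R) `[0, dt] = dt%:E.
  by rewrite lebesgue_measure_itv /= lte_fin; case: ltgtP dt0 => // [_|<-] _; rewrite ?sube0.
rewrite ger0_norm; last exact: Rintegral_ge0.
have dtE : Rintegral (@lebesgue_measure R) `[0, dt] (fun _ => 1) = dt.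
  by rewrite Rintegral_cst // mul1r; exact: (congr1 fine muI).
rewrite -[leRHS]dtE; apply: le_Rintegral => //.
- apply: measurable_bounded_integrable => //.
  + by rewrite [X in (X < _)%E]muI ltry.
  + exact: measurable_expm.
  + exists 1; split; first exact: num_real.
    by move=> M M1 s sI /=; rewrite ger0_norm ?f0 // (le_trans (f1 _ sI)) // ltW.
- apply: measurable_bounded_integrable => //.
  + by rewrite [X in (X < _)%E]muI ltry.
  + by exists 1; split => // M M1 s sI /=; rewrite normr1 ltW.
Qed.

End BirthDeath.

(** * Uniform bound on expected drops *)

Lemma convex_sum_le (R : realDomainType) (I : finType) (p h : I -> R) (C : R) :
  (forall i, 0 <= p i) -> \sum_i p i = 1 ->
  (forall i, `|h i| <= C) -> `|\sum_i p i * h i| <= C.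
Proof.
move=> p0 p1 hC; apply: (le_trans (ler_norm_sum _ _ _)).
have -> : C = \sum_i p i * C by rewrite -mulr_suml p1 mul1r.
by apply: ler_sum => i _; rewrite normrM ger0_norm // ler_wpM2l.
Qed.

Section DropBound.
Context {R : realType} {L : finType} {B : nat} (M : qmodel R L).
Hypothesis alpha_ge0 : 0 <= q_alpha M.
Hypothesis dt_ge0 : 0 <= q_dt M.
Hypothesis lam_ge0 : forall l, 0 <= q_lam M l.
Hypothesis K_ge0 : forall l l', 0 <= q_K M l l'.
Hypothesis K_sum : forall l, \sum_l' q_K M l l' = 1.
Hypothesis nu_ge0 : forall l, 0 <= q_nu M l.
Hypothesis nu_sum : \sum_l q_nu M l = 1.
Context (pi : nat -> 'I_B.+1 -> R) (pi01 : forall t z, 0 <= pi t z <= 1).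
Context {V : eqType} (nb : V -> seq V).

Lemma qrate_ge0 l a v : 0 <= l -> 0 <= qrate nb l a v :> R.
Proof.
move=> l0; rewrite mulr_ge0 // addr_ge0 ?sumr_ge0 //; first by case: ifP.
by move=> j _; case: ifP => //; rewrite invr_ge0.
Qed.

Lemma qrate_le d l a v : 0 <= l -> (size (nb v) <= d)%N ->
  qrate nb l a v <= l * (1 + d%:R) :> R.
Proof.
move=> l0 vd; rewrite ler_wpM2l // lerD //; first by case: ifP; rewrite ?ler01.
apply: (@le_trans _ _ (\sum_(j <- nb v) 1)).
  (* A neighbour with an empty list contributes [0^-1 = 0]. *)
  apply: ler_sum => j _; case: ifP => //; case: (size (nb j)) => [|m].
    by rewrite invr0.
  by rewrite invf_le1 ?ler1n ?ltr0n.
by rewrite big_const_seq count_predT iter_addr_0 ler_nat.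
Qed.

Let bern_ge0 t z b : 0 <= bern (pi t z) b.
Proof. by have /andP[? ?] := pi01 t z; case: b => //=; rewrite subr_ge0. Qed.

Let bern_sum t z : \sum_b bern (pi t z) b = 1.
Proof. by rewrite big_bool /= addrC subrK. Qed.

Lemma step_le s S h l z C : (forall k y, `|h k y| <= C) ->
  `|step M pi nb s S h l z| <= C.
Proof.
move=> hC; apply: (@sum_conf_weight_le _ _ _ _ _ (fun u b => bern (pi s (z u)) b)) => //.
  exact: undup_uniq.
move=> a; pose rate v := qrate nb (q_lam M l) a v.
have rate_ge0 v : 0 <= rate v by exact: qrate_ge0.
apply: (@sum_conf_weight_le _ _ _ _ _
  (fun v x => ptrans (q_alpha M) (q_dt M) (rate v) (z v) x)) => //.
- exact: undup_uniq.
- by move=> v x; exact: expm_bd_ge0.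
- by move=> v; exact: expm_bd_row_sum.
- by move=> y; exact: convex_sum_le.
Qed.

(** The bound does not grow with [n], since each [step] averages against probability weights; this
    gives uniformity over epochs. *)
Lemma cexp_le s n S g l z C : (forall k y, `|g k y| <= C) ->
  `|cexp M pi nb s n S g l z| <= C.
Proof.
move=> gC; elim: n s l z => [|n IH] s l z; first exact: gC.
by apply: step_le => k y; exact: IH.
Qed.

(** The sum over modulating states stands in for the maximal rate; the factor [1 + d] counts the own
    stream and at most [d] neighbours. *)
Definition drop_bound (d : nat) : R := (\sum_l q_lam M l) * (1 + d%:R) * q_dt M.

Lemma dropf_le d t v l z : (size (nb v) <= d)%N ->
  `|dropf M pi nb t v l z| <= drop_bound d.
Proof.
move=> vd; apply: (@sum_conf_weight_le _ _ _ _ _ (fun u b => bern (pi t (z u)) b)) => //.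
  exact: undup_uniq.
move=> a; have r0 : 0 <= qrate nb (q_lam M l) a v by exact: qrate_ge0.
apply: (le_trans (edrops_le alpha_ge0 r0 _ dt_ge0)); apply: ler_wpM2r => //.
apply: (le_trans (qrate_le a (lam_ge0 l) vd)); apply: ler_wpM2r.
  by rewrite addr_ge0.
by rewrite (bigD1 l) //= lerDl sumr_ge0.
Qed.

Lemma ED_le d z v t : (size (nb v) <= d)%N -> `|ED M pi nb z v t| <= drop_bound d.
Proof.
move=> vd; apply: convex_sum_le => // l; apply: cexp_le => k y.
exact: dropf_le.
Qed.

End DropBound.

(** * Convergence of bounded expectations *)

Section BoundedConvergence.
Context {d : measure_display} {W : measurableType d} {R : realType}.
Variable Q : probability W R.

Lemma bounded_integrable (f : W -> R) (C : R) : measurable_fun setT f ->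
  (forall w, `|f w| <= C) -> Q.-integrable setT (EFin \o f).
Proof.
move=> mf fC; apply: measurable_bounded_integrable => //.
  by rewrite [X in (X < _)%E]probability_setT ltry.
exists C; split; first exact: num_real.
by move=> D CD w _ /=; rewrite (le_trans (fC w)) // ltW.
Qed.

Lemma Rintegral_probability_cst (r : R) : Rintegral Q setT (fun=> r) = r.
Proof. by rewrite Rintegral_cst // [X in fine X]probability_setT mulr1. Qed.

Lemma cvg_Rintegral_in_probability (Y : nat -> W -> R) (C c : R) :
  (forall n, measurable_fun setT (Y n)) -> (forall n w, `|Y n w| <= C) ->
  (forall eps, 0 < eps ->
     (fun n => Q [set w | eps < `|Y n w - c|]) @ \oo --> 0%E) ->
  (fun n => Rintegral Q setT (Y n)) @ \oo --> c.
Proof.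
move=> mY YC Yc; pose D := C + `|c| + 1.
have D0 : 0 < D.
  by rewrite ltr_pwDr // addr_ge0 // (le_trans _ (YC 0 point)).
apply/cvgrPdist_le => e e0.
have e20 : 0 < e / 2 by rewrite divr_gt0.
have eD0 : 0 < e / 2 / D by rewrite divr_gt0.
near=> n.
have : fine (Q [set w | e / 2 < `|Y n w - c|]) <= e / 2 / D.
  near: n; have /fine_cvgP[_ /cvgrPdist_le/(_ _ eD0)] := Yc _ e20.
  by apply: filterS => n; rewrite sub0r normrN; apply: le_trans; exact: ler_norm.
set A := [set w | _] => QA.
have mYc : measurable_fun setT (fun w => c - Y n w).
  by apply: measurable_funB.
have mA : measurable A.
  rewrite -[A]setTI (_ : A = (fun w => `|Y n w - c|) @^-1` `]e / 2, +oo[); last first.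
    by apply/seteqP; split => w /=; rewrite in_itv /= andbT.
  apply: measurableT_comp => //; exact: measurable_funB.
have YcD w : `|c - Y n w| <= D.
  rewrite (le_trans (ler_normB _ _)) // addrC /D -addrA lerD // lerDl ler01 //.
have iYc := bounded_integrable mYc YcD.
have <- : Rintegral Q setT (fun w => c - Y n w) = c - Rintegral Q setT (Y n).
  rewrite RintegralB //; last exact: bounded_integrable (mY n) (YC n).
    by rewrite Rintegral_probability_cst.
  by apply: (@bounded_integrable _ `|c|).
apply: (le_trans (le_normr_Rintegral _ iYc)) => //.
have m1 : measurable_fun setT (\1_A : W -> R) by exact: measurable_indic.
have i1 : Q.-integrable setT (EFin \o (fun w => D * \1_A w)).
  apply: (@bounded_integrable _ D); first exact: measurable_funM.
  by move=> w; rewrite indicE normrM (gtr0_norm D0); case: (_ \in _); rewrite ?normr1 ?normr0 ?mulr1 ?mulr0 // ltW.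
have ie : Q.-integrable setT (EFin \o (fun _ => e / 2)).
  by apply: (@bounded_integrable _ `|e / 2|).
apply: (@le_trans _ _ (Rintegral Q setT (fun w => e / 2 + D * \1_A w))).
  apply: le_Rintegral => //.
  - apply: (@bounded_integrable _ D); first exact: measurableT_comp.
    by move=> w; rewrite normr_id.
  - apply: (@bounded_integrable _ (e / 2 + D)).
      by apply: measurable_funD => //; exact: measurable_funM.
    move=> w; rewrite indicE ger0_norm.
      by rewrite lerD2l; case: (_ \in _); rewrite ?mulr1 ?mulr0 // ltW.
    by rewrite addr_ge0 ?mulr_ge0 // ltW.
  - move=> w _; rewrite indicE; case: (boolP (w \in A)) => [_|].
      by rewrite mulr1 (le_trans (YcD w)) // lerDr ltW.
    by rewrite notin_setE /A /= mulr0 addr0 distrC => /negP; rewrite -leNgt.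
rewrite RintegralD // Rintegral_probability_cst [leRHS]splitr lerD2l.
rewrite RintegralZl //; last by apply: (@bounded_integrable _ 1) => // w;
  rewrite indicE; case: (_ \in _); rewrite ?normr1 ?normr0.
have -> : Rintegral Q setT (\1_A) = fine (Q A).
  by rewrite /Rintegral integral_indic // setIT.
rewrite mulrC -ler_pdivlMr //.
Unshelve. all: by end_near. Qed.

End BoundedConvergence.

(** * The discounted cost as a local function *)

Section Discount.
Context {R : realType} (gamma C : R).
Hypotheses (gamma_gt0 : 0 < gamma) (gamma_lt1 : gamma < 1).
Implicit Types u v : R^nat.

Let disc u m : R := \sum_(t < m) gamma ^+ t * u t.

Let norm_gamma : `|gamma| < 1.
Proof. by rewrite gtr0_norm. Qed.

Lemma is_cvg_discounted u : (forall t, `|u t| <= C) -> cvgn (disc u).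
Proof.
move=> uC; have -> : disc u = series (fun t => gamma ^+ t * u t).
  by apply/funext => m; rewrite /disc /series /= big_mkord.
apply: normed_cvg.
apply: (series_le_cvg _ _ _ (@is_cvg_geometric_series _ C gamma norm_gamma)) => t /=.
- exact: normr_ge0.
- by apply: geometric_ge0; [exact: le_trans (uC 0%N) | exact: ltW].
- rewrite normrM normrX gtr0_norm // mulrC.
  by apply: ler_wpM2r => //; rewrite exprn_ge0 // ltW.
Qed.

Lemma discounted_tail_le u k : (forall t, `|u t| <= C) ->
  (forall t, (t < k)%N -> u t = 0) ->
  `|limn (disc u)| <= C * gamma ^+ k / (1 - gamma).
Proof.
move=> uC u0; have C0 : 0 <= C by exact: le_trans (uC 0%N).
have cu := is_cvg_discounted uC.
rewrite -lim_norm //; apply: limr_le; first exact: is_cvg_norm.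
near=> m; have km : (k <= m)%N by near: m; exact: nbhs_infty_ge.
rewrite /disc -(subnKC km) big_split_ord /= big1 ?add0r; last first.
  by move=> t _; rewrite u0 ?mulr0.
apply: (le_trans (ler_norm_sum _ _ _)).
have Ck0 : 0 <= C * gamma ^+ k by rewrite mulr_ge0 // exprn_ge0 // ltW.
apply: le_trans (geometric_le_lim (m - k) Ck0 gamma_gt0 norm_gamma).
rewrite /series /= big_mkord; apply: ler_sum => t _.
rewrite normrM normrX gtr0_norm // exprD mulrC mulrA.
by do 2 (apply: ler_wpM2r; first by rewrite exprn_ge0 // ltW).
Unshelve. all: by end_near. Qed.

Lemma discounted_le u : (forall t, `|u t| <= C) ->
  `|limn (disc u)| <= C / (1 - gamma).
Proof. by move=> uC; have := @discounted_tail_le u 0 uC; rewrite expr0 mulr1; exact. Qed.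

End Discount.

Lemma discounted_sub_le (R : realType) (gamma C : R) (u v : R^nat) k :
  0 < gamma -> gamma < 1 -> (forall t, `|u t| <= C) -> (forall t, `|v t| <= C) ->
  (forall t, (t < k)%N -> u t = v t) ->
  `|limn (fun m => \sum_(t < m) gamma ^+ t * u t) -
    limn (fun m => \sum_(t < m) gamma ^+ t * v t)| <=
  (C + C) * gamma ^+ k / (1 - gamma).
Proof.
move=> g0 g1 uC vC uv; rewrite -limB; try exact: is_cvg_discounted.
rewrite [X in limn X](_ : _ = fun m => \sum_(t < m) gamma ^+ t * (u t - v t)); last first.
  apply/funext => m; rewrite !fctE -sumrB.
  by apply: eq_bigr => t _; rewrite mulrBr.
apply: (@discounted_tail_le _ gamma (C + C) g0 g1 (fun t => u t - v t)) => t.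
  by apply: (le_trans (ler_normB _ _)); exact: lerD.
by move=> tk; rewrite uv // subrr.
Qed.

Lemma uniq_map_inj (T T' : eqType) (f : T -> T') (s : seq T) :
  uniq (map f s) -> {in s &, injective f}.
Proof.
elim: s => //= a s IH /andP[fa us] x y; rewrite !inE.
move=> /predU1P[->|xs] /predU1P[->|ys] // fxy; last exact: IH.
- by move: fa; rewrite fxy map_f.
- by move: fa; rewrite -fxy map_f.
Qed.

Section RootedGraphs.
Context {B : nat}.
Implicit Types g h : rmgraph B.

Lemma ballE (nb : nat -> seq nat) k r  : Defs.ball nb k r = growN nb k [:: r].
Proof. by elim: k => [//|k IH] /=; rewrite IH. Qed.

Lemma ball_iso_local k g h : rgood g -> rgood h -> ball_iso k.+1 g h ->
  let G := growN (rnb g)^~ [:: rroot g] in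
  exists phi : nat -> nat, [/\ phi (rroot g) = rroot h,
    {in G k.+1 &, injective phi},
    {in G k, forall v, perm_eq (map phi (rnb g v)) (rnb h (phi v))} &
    {in G k.+1, rmark h \o phi =1 rmark g}].
Proof.
move=> gg gh [phi [phir pb mk adj]] G; exists phi; move: pb mk adj.
rewrite !ballE -/(G k.+1); set H := growN (rnb h)^~ [:: rroot h].
rewrite -/(H k.+1) => pb mk adj.
have phiI : {in G k.+1 &, injective phi}.
  by apply: uniq_map_inj; rewrite (perm_uniq pb) undup_uniq.
split=> // v vG.
have GH j w : (j <= k.+1)%N -> w \in G j -> phi w \in H j.
  elim: j w => [|j IH] w jk; first by rewrite !inE => /eqP ->; rewrite phir.
  rewrite /G /= mem_nbhd -/(G j) => /orP[wG|/hasP[u uG wu]].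
    by apply: sub_nbhd; apply: IH => //; exact: ltnW.
  apply: (@nb_nbhd _ _ _ (phi u)); first by apply: IH => //; exact: ltnW.
  rewrite adj //; first exact: (@sub_growN _ _ j k.+1 _ (ltnW jk)).
  by apply: (@sub_growN _ _ j.+1 k.+1 _ jk); exact: nb_nbhd wu.
have vH := GH k v (leqnSn k) vG.
have [ug _ _] : [/\ uniq (rnb g v), v \notin rnb g v &
    forall u, (u \in rnb g v) = (v \in rnb g u)].
  by apply: gg; exists k; rewrite ballE.
have [uh _ _] : [/\ uniq (rnb h (phi v)), phi v \notin rnb h (phi v) &
    forall u, (u \in rnb h (phi v)) = (phi v \in rnb h u)].
  by apply: gh; exists k; rewrite ballE.
have vG1 : v \in G k.+1 by exact: sub_nbhd.
have nG w : w \in rnb g v -> w \in G k.+1 by exact: nb_nbhd.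
apply: uniq_perm => //.
  by rewrite map_inj_in_uniq // => x y /nG xG /nG; exact: phiI.
move=> w; apply/mapP/idP => [[u uv ->]|wv]; first by rewrite adj // nG.
have : w \in H k.+1 by exact: nb_nbhd wv.
rewrite -(perm_mem pb) => /mapP[u uG wE]; exists u => //.
by rewrite -(adj _ _ vG1 uG) -wE.
Qed.

Section Truncation.
Context {R : realType} {L : finType} (M : qmodel R L) (gamma : R).
Context (pi : nat -> 'I_B.+1 -> R) (d : nat).

(* Expected drops are unbounded over all locally finite graphs, whereas test   *)
(* functions must be bounded there: hence the cut-off at roots of degree > d.  *)
Definition EDcut (t : nat) g : R :=
  if (size (rnb g (rroot g)) <= d)%N then ED M pi (rnb g) (rmark g) (rroot g) t
  else 0.

Definition Jcut g : R := - limn (fun m => \sum_(t < m) gamma ^+ t * EDcut t g).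

Lemma EDcut_iso t k g h : rgood g -> rgood h -> ball_iso k g h -> (t.+1 < k)%N ->
  EDcut t g = EDcut t h.
Proof.
case: k => // k gg gh /(ball_iso_local gg gh)[phi [phir phiI nG mk]].
rewrite ltnS => tk; have s1 := @sub_growN _ (rnb g) _ _ [:: rroot g] tk.
have s2 := @sub_growN _ (rnb g) _ _ [:: rroot g] (leqW tk).
rewrite /EDcut -phir.
have rG : rroot g \in growN (rnb g) k [:: rroot g].
  exact: (@sub_growN _ _ 0 k _ (leq0n k) _ (mem_head _ _)).
rewrite -(perm_size (nG _ rG)) size_map; case: ifP => // _.
apply: ED_iso => [v /s1|v w /s2 vG /s2|v /s2]; [exact: nG | exact: phiI | exact: mk].
Qed.

Lemma Jcut_froot (H : mfgraph B) (i : 'I_(fN H)) : (size (fnb i) <= d)%N ->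
  Jcut (Defs.froot i) = - limn (fun m => \sum_(t < m) gamma ^+ t *
                                    ED M pi (@fnb B H) (@fmark B H) i t).
Proof.
move=> deg_i; rewrite /Jcut; congr (- limn _); apply/funext => m.
apply: eq_bigr => t _; rewrite /EDcut /= valK size_map deg_i; congr (_ * _).
apply: esym; apply: (@ED_iso _ _ _ M pi _ _ val) => [v _|v w _ _|v _] /=; first by rewrite valK.
  exact: val_inj.
by rewrite valK.
Qed.

Hypotheses (gamma_gt0 : 0 < gamma) (gamma_lt1 : gamma < 1).
Variable C : R.
Hypotheses (C_ge0 : 0 <= C)
  (ED_C : forall (V : eqType) (nb : V -> seq V) z v t,
     (size (nb v) <= d)%N -> `|ED M pi nb z v t| <= C).

Lemma EDcut_le t g : `|EDcut t g| <= C.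
Proof. by rewrite /EDcut; case: ifP => [/ED_C //|_]; rewrite normr0. Qed.

Lemma Jcut_le g : `|Jcut g| <= C / (1 - gamma).
Proof. by rewrite normrN; exact: (@discounted_le _ gamma C gamma_gt0 gamma_lt1 (EDcut^~ g) (EDcut_le^~ g)). Qed.

Lemma Jcut_continuous : lw_continuous Jcut.
Proof.
move=> g gg eps eps0.
have norm_gamma : `|gamma| < 1 by rewrite gtr0_norm.
have /cvgrPdist_lt/(_ _ eps0)[k _ ltk] :=
  @cvg_geometric _ ((C + C) / (1 - gamma)) gamma norm_gamma.
exists k.+1 => h gh gh_iso; rewrite /Jcut -opprD normrN.
apply: le_lt_trans (ltk k (leqnn k)).
rewrite sub0r normrN /=; apply: le_trans (ler_norm _).
rewrite mulrAC; apply: (@discounted_sub_le _ _ _ (EDcut^~ g) (EDcut^~ h)) => // t.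
- exact: EDcut_le.
- exact: EDcut_le.
- by move=> tk; exact: (EDcut_iso gg gh gh_iso).
Qed.

Lemma Jfin_emp_avg (H : mfgraph B) : mfgraph_ok d H ->
  Jfin M gamma pi H = emp_avg Jcut H.
Proof.
move=> [_ okH]; have degH (i : 'I_(fN H)) : (size (fnb i) <= d)%N.
  by have [_ _ /andP[]] := okH i.
rewrite /Jfin /emp_avg; under [in RHS]eq_bigr do rewrite Jcut_froot //.
rewrite sumrN mulrN; congr (- _); rewrite mulr_sumr.
pose s (i : 'I_(fN H)) m : R :=
  \sum_(t < m) gamma ^+ t * ED M pi (@fnb B H) (@fmark B H) i t.
have cs := @cvg_sumr R _ (index_enum _) (fun i m => (fN H)%:R^-1 * s i m)
  (fun i => (fN H)%:R^-1 * limn (s i)).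
rewrite -[RHS](cvg_lim (@Rhausdorff R) (cs _)); last first.
  move=> i; apply: cvgMl_tmp; apply: (is_cvg_discounted gamma_gt0 gamma_lt1 (C := C)) => t.
  exact: ED_C.
congr (limn _); apply/funext => m.
under [RHS]eq_bigr do rewrite mulr_sumr.
rewrite exchange_big /=; apply: eq_bigr => t _.
rewrite !mulr_sumr; apply: eq_bigr => i _; exact: mulrCA.
Qed.

End Truncation.

End RootedGraphs.

Lemma emp_avg_le (R : realType) (B : nat) (f : rmgraph B -> R) (H : mfgraph B) C :
  (0 < fN H)%N -> (forall g, `|f g| <= C) -> `|emp_avg f H| <= C.
Proof.
move=> H0 fC; rewrite /emp_avg mulr_sumr; apply: convex_sum_le => //.
by rewrite sumr_const card_ord -[LHS]mulr_natl mulfV // pnatr_eq0 -lt0n.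
Qed.

Theorem theorem2p1
  (R : realType) (d B : nat) (alpha dt gamma : R)
  (L : finType) (lam : L -> R) (K : L -> L -> R) (nu : L -> R)
  (halpha : 0 < alpha) (hdt : 0 < dt) (hgamma0 : 0 < gamma) (hgamma1 : gamma < 1)
  (hlam : forall l, 0 < lam l)
  (hK0 : forall l l', 0 <= K l l') (hK1 : forall l, \sum_(l' : L) K l l' = 1)
  (hnu0 : forall l, 0 <= nu l) (hnu1 : \sum_(l : L) nu l = 1)
  (* the (possibly random) finite graphs G_n, on a probability space (W', Q) *)
  (dQ : measure_display) (W' : measurableType dQ) (Q : probability W' R)
  (Gn : nat -> W' -> mfgraph B)
  (hGn_ok : forall n w, mfgraph_ok d (Gn n w))
  (hGn_meas : forall n (A : set (mfgraph B)), measurable (Gn n @^-1` A))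
  (* the (possibly random) limit (G, root, z), on a probability space (W, P) *)
  (dP : measure_display) (W : measurableType dP) (P : probability W R)
  (X : W -> rmgraph B)
  (hX_good : forall w, rgood (X w)) (hX_deg : forall w, rdeg_ok d (X w))
  (hX_meas : forall f : rmgraph B -> R, lw_bounded f -> lw_continuous f ->
               measurable_fun setT (f \o X))
  (* local weak convergence in probability *)
  (hconv : forall f : rmgraph B -> R, lw_bounded f -> lw_continuous f ->
     forall eps : R, 0 < eps ->
       (fun n => Q [set w | eps < `| emp_avg f (Gn n w)
                                    - Rintegral P setT (f \o X) |]) @ \oo --> 0%E)
  (* any policy *)
  (pi : nat -> 'I_B.+1 -> R) (hpi : forall t z, 0 <= pi t z <= 1) :
  (fun n : nat => Rintegral Q setT
              (fun w => Jfin (QModel alpha dt lam K nu) gamma pi (Gn n w)) : R)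
    @ \oo -->
  (Rintegral P setT (fun w => Jroot (QModel alpha dt lam K nu) gamma pi (X w)) : R).
Proof.
set M := QModel alpha dt lam K nu; pose f := @Jcut B R L M gamma pi d.
pose C := drop_bound M d.
have C0 : 0 <= C.
  rewrite /C /drop_bound mulr_ge0 ?(ltW hdt) // mulr_ge0 ?addr_ge0 //.
  by apply: sumr_ge0 => l _; exact: ltW.
have ED_C (V : eqType) (nb : V -> seq V) z v t :
    (size (nb v) <= d)%N -> `|ED M pi nb z v t| <= C.
  by apply: ED_le => //= *; exact: ltW.
have f_le g : `|f g| <= C / (1 - gamma) by exact: Jcut_le.
have f_bounded : lw_bounded f by exists (C / (1 - gamma)) => g _.
have f_cont : lw_continuous f by exact: (Jcut_continuous hgamma0 hgamma1 C0 ED_C).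
have -> : (fun w => Jroot M gamma pi (X w)) = f \o X.
  apply/funext => w /=; rewrite /f /Jcut /Jroot /EDcut.
  have Xroot : reachable (X w) (rroot (X w)) by exists 0%N; rewrite mem_head.
  by have /andP[_ ->] := hX_deg w _ Xroot.
under eq_fun do under eq_fun do rewrite (Jfin_emp_avg hgamma0 hgamma1 ED_C (hGn_ok _ _)).
apply: (@cvg_Rintegral_in_probability _ _ _ Q _ (C / (1 - gamma))).
- by move=> n _ Y mY; rewrite setTI; exact: (hGn_meas n (emp_avg f @^-1` Y)).
- by move=> n w; apply: emp_avg_le => //; have [] := hGn_ok n w.
- exact: hconv.
Qed.
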